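(* There exist universal constants $L>0$, $b>0$ such that for every even integer $\alpha\ge2$ and every $t>0$, $$\max\Big\{\mathbb{P}(|\mathbb{H}^{(2)}_\alpha(0)|>t),\ \mathbb{P}(|\mathbb{H}^{(3)}_\alpha(0)|>t),\ \mathbb{P}(h^*_{\alpha;-}>t),\ \mathbb{P}(h^*_{\alpha;+}>t)\Big\}\le L\exp(-t^b/L).$$
   Context: $\mathbb{B}$ is a standard two-sided Brownian motion with $\mathbb{B}(0)=0$. For an even integer $\alpha\ge2$, $\mathbb{Y}_\alpha(t)=\int_0^t\mathbb{B}(s)ds+t^{\alpha+2}$, and $\mathbb{H}_\alpha$ is the almost surely uniquely defined random continuous function with $\mathbb{H}_\alpha(t)\ge\mathbb{Y}_\alpha(t)$ for all $t$, convex second derivative $\mathbb{H}_\alpha^{(2)}$, and $\int_{-\infty}^\infty(\mathbb{H}_\alpha-\mathbb{Y}_\alpha)\,d\mathbb{H}_\alpha^{(3)}=0$. $h^*_{\alpha;-}$ (resp. $h^*_{\alpha;+}$) is the absolute value of the location of the first touch point (point where $\mathbb{H}_\alpha=\mathbb{Y}_\alpha$) to the left (resp. right) of $0$. *)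

(* Defs.v *)
From HB Require Import structures.
From mathcomp Require Import all_boot all_order all_algebra.
From mathcomp Require Import all_classical all_reals all_analysis.
Set Implicit Arguments. Unset Strict Implicit. Unset Printing Implicit Defensive.
Import Order.TTheory GRing.Theory Num.Theory.
Import numFieldNormedType.Exports.
Local Open Scope classical_set_scope.
Local Open Scope ring_scope.

Section Defs.
Context {R : realType} {d : measure_display} {Omega : measurableType d}.

Definition outerP (P : probability Omega R) (E : set Omega) : \bar R :=
  ereal_inf [set P A | A in [set A | measurable A /\ E `<=` A]].

Definition two_sided_BM (P : probability Omega R) (B : R -> Omega -> R) : Prop :=
  [/\ (forall t, measurable_fun setT (B t)),
      {ae P, forall w, B 0 w = 0 /\ continuous (fun t => B t w)} &
      (forall (n : nat) (t : nat -> R) (A : nat -> set R),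
         (forall i, (i < n)%N -> t i < t i.+1) ->
         (forall i, measurable (A i)) ->
         P (\bigcap_(i in [set i | (i < n)%N])
              [set w | A i (B (t i.+1) w - B (t i) w)])
         = (\prod_(i < n) normal_prob 0 (Num.sqrt (t i.+1 - t i)) (A i))%E)].

Definition integral0 (f : R -> R) (t : R) : R :=
  if 0 <= t then Rintegral lebesgue_measure `[0, t] f
  else - Rintegral lebesgue_measure `[t, 0] f.

Definition Yproc (alpha : nat) (B : R -> Omega -> R) (w : Omega) (t : R) : R :=
  integral0 (fun s => B s w) t + t ^+ (alpha + 2).

End Defs.

Section Invelope.
Context {R : realType}.

Definition convex_fun (f : R -> R) : Prop :=
  forall x y l : R, 0 <= l -> l <= 1 ->
    f (l * x + (1 - l) * y) <= l * f x + (1 - l) * f y.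

Definition deriv2 (h : R -> R) : R -> R := derive1 (derive1 h).

Definition rderiv (f : R -> R) (x : R) : R :=
  lim ((fun e => (f (x + e) - f x) / e) @ at_right 0).

(* third derivative of h: right derivative of the (convex) second derivative *)
Definition deriv3 (h : R -> R) : R -> R := rderiv (deriv2 h).

Definition invelope (h y : R -> R) : Prop :=
  [/\ (forall t, y t <= h t),
      (forall t, derivable h t 1 /\ derivable (derive1 h) t 1),
      convex_fun (deriv2 h) &
      exists F : cumulative R R, (forall x, F x = deriv3 h x) /\
        (\int[lebesgue_stieltjes_measure F]_x ((h x - y x)%:E) = 0)%E].

(* absolute value of the first touch point to the left / right of 0
   (+oo if there is none) *)
Definition hminus (h y : R -> R) : \bar R :=
  (- ereal_sup (EFin @` [set s : R | (s < 0)%R /\ h s = y s]))%E.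
Definition hplus (h y : R -> R) : \bar R :=
  ereal_inf (EFin @` [set s : R | (0 < s)%R /\ h s = y s]).

End Invelope.

(* Main.v *)
(** Write y = X + t^n with n = alpha + 2 and X' = B, and let g be the (convex) second
derivative of H and F its third (right) derivative.  Off an event of probability
O(exp(-x)) the path satisfies |B t| <= M (1 + |t|) with M = 30 x; this only needs a union
bound over dyadic increments and over the integers.  The rest is deterministic, with
bounds linear in M and uniform in alpha.

On a maximal interval [m-r, m+r] without touch points in its interior, H is the cubic
Hermite interpolant of y, so H m >= y m says that the midpoint error of Hermite
interpolation of y is nonpositive.  For f = t^n with n even this error is a sum of
nonnegative terms that controls r (f'(m+r) - f'(m-r)), uniformly in n as soon as
|m| <= 20 r; for X it is O(r M (1 + r)).  Hence r = O(M), which bounds the distance to the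
first touch points, and |g| = O(M) on the interval when r is not small.

Inside [-3/4, 3/4], where f' stays bounded uniformly in n, every window of length 1/4
contains a point with |g| = O(M): either part of the window lies in a gap of length at
least 1/12, or the mean value theorem applies to H' between two touch points at distance
at least 1/12, where H' = y'.  Convexity of g then bounds g 0 and F 0. *)

Require Import Defs.
From HB Require Import structures.
From mathcomp Require Import all_boot all_order all_algebra.
From mathcomp Require Import all_classical all_reals all_analysis.
From mathcomp Require Import measurable_realfun ring lra zify.
Set Implicit Arguments. Unset Strict Implicit. Unset Printing Implicit Defensive.
Import Order.TTheory GRing.Theory Num.Theory.
Import numFieldNormedType.Exports.
Local Open Scope classical_set_scope.
Local Open Scope ring_scope.

(** * Binomial expansions of even powers and their Hermite midpoint error *)

Section PowerFunctional.
Context {R : realFieldType}.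
Implicit Types (m r : R) (n k : nat).

Definition binom_term m r n k : R := 'C(n, k)%:R * (m ^+ (n - k) * r ^+ k).

Lemma exprDn_binom_term m r n :
  (m + r) ^+ n = \sum_(k < n.+1) binom_term m r n k.
Proof. by rewrite exprDn; apply: eq_bigr => k _; rewrite /binom_term -mulr_natl. Qed.

Lemma binom_termN m r n k : binom_term m (- r) n k = (-1) ^+ k * binom_term m r n k.
Proof. by rewrite /binom_term [X in m ^+ _ * X]exprNn; move: ((-1) ^+ k) => s; ring. Qed.

(** The operator [r * d/dr] multiplies the term of degree [k] in [r] by [k]. *)
Lemma deriv_exprDn_binom_term m r n :
  r * (n%:R * (m + r) ^+ n.-1) = \sum_(k < n.+1) k%:R * binom_term m r n k.
Proof.
case: n => [|n]; first by rewrite big_ord_recl big_ord0 !mul0r mulr0 addr0.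
rewrite big_ord_recl mul0r add0r /= exprDn_binom_term !mulr_sumr.
apply: eq_bigr => k _; rewrite /binom_term /bump /= add1n subSS exprS.
have -> : (k.+1%:R : R) * ('C(n.+1, k.+1)%:R * (m ^+ (n - k) * (r * r ^+ k)))
  = (k.+1 * 'C(n.+1, k.+1))%:R * (m ^+ (n - k) * (r * r ^+ k)) by rewrite natrM; ring.
by rewrite -mul_bin_diag natrM /=; ring.
Qed.

Lemma binom_term_ge0 m r n k : ~~ odd n -> ~~ odd k -> (k <= n)%N ->
  0 <= binom_term m r n k.
Proof.
move=> nn nk kn; rewrite /binom_term mulr_ge0 ?ler0n// mulr_ge0//.
- by rewrite exprn_even_ge0// oddB// (negbTE nn) (negbTE nk).
- by rewrite exprn_even_ge0.
Qed.

Lemma rderiv_power_gap m r n :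
  r * (n%:R * (m + r) ^+ n.-1 - n%:R * (m - r) ^+ n.-1) =
  \sum_(k < n.+1) (1 + (-1) ^+ k) * (k%:R * binom_term m r n k).
Proof.
have h := deriv_exprDn_binom_term m (- r) n.
rewrite mulrBr deriv_exprDn_binom_term -[- (r * _)]mulNr h -big_split/=.
by apply: eq_bigr => k _; rewrite binom_termN; ring.
Qed.

Lemma signr_even_cases k : (1 + (-1) ^+ k : R) = 2 * (~~ odd k)%:R.
Proof. by rewrite -signr_odd; case: (odd k); rewrite /= ?expr0 ?expr1; ring. Qed.

(** Only the top term [k = n] of [rderiv_power_gap] is kept. The odd terms cancel and the other even
    ones are nonnegative for every [m], so the bound is uniform in [m]. *)
Lemma deriv_power_gap_ge m r n : ~~ odd n -> (4 <= n)%N -> 1 <= r ->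
  r ^+ 3 <= n%:R * (m + r) ^+ n.-1 - n%:R * (m - r) ^+ n.-1.
Proof.
move=> nn n4 r1; have r0 : 0 < r by lra.
rewrite -(ler_pM2l r0) rderiv_power_gap big_ord_recr /= -exprS.
apply: (@le_trans _ _ (2 * (n%:R * r ^+ n))); last first.
  rewrite signr_even_cases nn mulr1 /binom_term subnn binn expr0 !mul1r lerDr.
  apply: sumr_ge0 => k _; rewrite signr_even_cases.
  have [ok|ek] := boolP (odd k); first by rewrite mulr0 mul0r.
  by rewrite mulr_ge0// mulr_ge0// binom_term_ge0// ltnW.
have h1 : r ^+ 4 <= r ^+ n by rewrite ler_weXn2l.
have h2 : 4 <= n%:R :> R by rewrite (ler_nat _ 4).
have h3 : 0 < r ^+ n by rewrite exprn_gt0.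
by nra.
Qed.

(** Induction by Pascal's rule from equality at [n = 4]; the step needs the same comparison between
    ['C(n, 1)] and ['C(n, 3)], proved by an inner induction. *)
Lemma bin2_le_bin4 n : (4 <= n)%N -> ('C(n, 2) <= 6 * 'C(n, 4))%N.
Proof.
elim: n => [//|n IH]; rewrite leq_eqVlt => /predU1P[<-//|]; rewrite ltnS => n4.
have h2 : (1 <= 'C(n, 2))%N by rewrite bin_gt0; lia.
have h3 : ('C(n, 1) <= 6 * 'C(n, 3))%N.
  elim: n n4 {IH h2} => [//|n IH]; rewrite leq_eqVlt => /predU1P[<-//|].
  rewrite ltnS => n4; have h2 : (1 <= 'C(n, 2))%N by rewrite bin_gt0; lia.
  by move: (IH n4); rewrite !binS bin0; lia.
by move: (IH n4); rewrite !(binS n); lia.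
Qed.

(** Lowering the weight [1 / 4] of the derivative gap by [1 / 10000] gives the [k = 2] term the
    coefficient [- 4 / 10000] and leaves [9992 / 10000] on the [k = 4] term. The former term is at
    most 2400 times the latter, and [2400 * 4 <= 9992]. *)
Definition hermite_const : R := 10000.

Lemma hermite_const_ge1 : 1 <= hermite_const.
Proof. by rewrite /hermite_const ler1n. Qed.

(* The right-hand side is the error at the midpoint of cubic Hermite
   interpolation of t^n on [m-r, m+r]; in powers of r it equals the sum over even
   k >= 4 of C(n,k) (k/2 - 1) m^(n-k) r^k.  Only the k = 2 term of the derivative
   gap is missing there, and it is absorbed by the k = 4 term. *)
Lemma hermite_error_power m r n : ~~ odd n -> (4 <= n)%N -> 0 < r ->
  `|m| <= 20 * r ->
  r / hermite_const * (n%:R * (m + r) ^+ n.-1 - n%:R * (m - r) ^+ n.-1) <=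
  m ^+ n - ((m - r) ^+ n + (m + r) ^+ n) / 2
   + r / 4 * (n%:R * (m + r) ^+ n.-1 - n%:R * (m - r) ^+ n.-1).
Proof.
move=> nn n4 r0 mr; rewrite -subr_ge0 /hermite_const.
set D := (_ - n%:R * (m - r) ^+ _).
have -> : m ^+ n - ((m - r) ^+ n + (m + r) ^+ n) / 2 + r / 4 * D - r / 10000 * D
  = m ^+ n - ((m - r) ^+ n + (m + r) ^+ n) / 2 + 2499 / 10000 * (r * D) by field.
rewrite /D rderiv_power_gap.
have -> : ((m - r) ^+ n + (m + r) ^+ n) / 2 =
  \sum_(k < n.+1) (1 + (-1) ^+ k) * (binom_term m r n k / 2).
  rewrite (exprDn_binom_term m r) (exprDn_binom_term m (- r)) -big_split/=.
  rewrite mulr_suml; apply: eq_bigr => k _; rewrite binom_termN; by field.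
rewrite -addrA mulr_sumr addrC -sumrN -big_split/=.
case: n nn n4 {D} => [|[|[|[|n]]]]// nn _.
rewrite !big_ord_recl /= /bump /=.
(* The terms [k = 0] to [4] have been split off. In [S] every even [k] exceeds 4, so its coefficient
   [2 * (2499 / 10000 * k - 1 / 2)] is nonnegative. *)
set S := \sum_(i < n) _.
have S0 : 0 <= S.
  apply: sumr_ge0 => k _; rewrite signr_even_cases !add1n.
  have [ok|ek] := boolP (odd k.+4.+1); first by rewrite !mulr0 !mul0r; lra.
  have := @binom_term_ge0 m r n.+4 k.+4.+1 nn ek.
  have := ltn_ord k; rewrite -(ltn_add2r 4) !addn4 => kn /(_ kn).
  set b := binom_term _ _ _ _ => b0.
  rewrite mulr1n.
  have k4 : 4 <= k.+4.+1%:R :> R by rewrite (ler_nat _ 4).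
  by move: (k.+4.+1%:R) k4 => K k4; nra.
rewrite !signr_even_cases /= /binom_term bin0 !subn0 !expr0 !subSS subn0.
set B2 := ('C(n.+4, 2)%:R); set B4 := ('C(n.+4, 4)%:R).
have B24 : B2 <= 6 * B4 by rewrite -natrM ler_nat bin2_le_bin4.
have B2ge0 : 0 <= B2 by rewrite ler0n.
rewrite !subn0.
have -> : m ^+ n.+2 = m ^+ n * m ^+ 2 by rewrite -exprD addn2.
have mn0 : 0 <= m ^+ n by rewrite exprn_even_ge0//; move: nn; rewrite /= !negbK.
set P := m ^+ n in mn0 *.
have m2 : m ^+ 2 <= 400 * r ^+ 2.
  have : `|m| ^+ 2 <= (20 * r) ^+ 2 by rewrite ler_pXn2r// nnegrE//; lra.
  by rewrite -normrX ger0_norm ?sqr_ge0//; lra.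
(* The factor is [2400 = 6 * 400]: 6 from the binomial coefficients and 400 from
   [m ^+ 2 <= 400 * r ^+ 2]. *)
have key : B2 * (P * m ^+ 2 * r ^+ 2) <= 2400 * (B4 * (P * r ^+ 4)).
  apply: (@le_trans _ _ (6 * B4 * (P * (400 * r ^+ 2) * r ^+ 2))); last first.
    by rewrite le_eqVlt; apply/orP; left; apply/eqP; ring.
  apply: ler_pM => //; first by apply: mulr_ge0; [apply: mulr_ge0 => //|]; exact: sqr_ge0.
  by apply: ler_wpM2r; [rewrite sqr_ge0|exact: ler_wpM2l].
have B4ge0 : 0 <= B4 by rewrite ler0n.
have key0 : 0 <= B4 * (P * r ^+ 4).
  by apply: mulr_ge0 => //; apply: mulr_ge0 => //; apply: exprn_ge0; exact: ltW.
have -> : (1 + 1 = 2)%N by [].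
have -> : (1 + (1 + (1 + 1)) = 4)%N by [].
rewrite /B2 /B4 in key key0 *.
move: key key0; set U := (_ * (_ * _ * r ^+ 2)); set V := (_ * (P * r ^+ 4)) => key key0.
lra.
Qed.

End PowerFunctional.
Arguments hermite_const {R}.

(** * One-variable calculus: mean values, extremal zeros, cubics *)

Section RealCalculus.
Context {R : realType}.
Implicit Types (f df g k : R -> R) (a b c m s u x : R).

Lemma is_derive_continuous f df : (forall x : R, is_derive x 1 f (df x)) -> continuous f.
Proof.
by move=> fd x; apply/differentiable_continuous/derivable1_diffP; have [] := fd x.
Qed.

Lemma MVT_everywhere f df a b : (forall x : R, is_derive x 1 f (df x)) -> a < b ->
  exists c, [/\ a < c, c < b & f b - f a = df c * (b - a)].
Proof.
move=> fd ab; have fc := is_derive_continuous fd.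
have [|c + e] := @MVT R f df a b ab (fun x _ => fd x).
  exact: continuous_subspaceT.
by rewrite in_itv/= => /andP[ac cb]; exists c.
Qed.

Lemma is_derive0_constant f df a b m x :
  (forall t : R, is_derive t 1 f (df t)) -> (forall t, a < t -> t < b -> df t = 0) ->
  a < m -> m < b -> a <= x -> x <= b -> f x = f m.
Proof.
move=> fd df0 am mb ax xb; have [xm|mx|->//] := ltgtP x m.
- have [c [xc cm e]] := MVT_everywhere fd xm.
  by move: e; rewrite df0 ?mul0r; lra.
- have [c [xc cm e]] := MVT_everywhere fd mx.
  by move: e; rewrite df0 ?mul0r; lra.
Qed.

(** The point is the supremum of the zeros below [u]; continuity makes it a zero, since otherwise
    [k] would not vanish near it. *)
Lemma last_zero k s u : continuous k -> k s = 0 -> s <= u ->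
  exists a, [/\ s <= a, a <= u, k a = 0 & forall x, a < x -> x <= u -> k x <> 0].
Proof.
move=> kc ks su; pose S : set R := [set x | x <= u /\ k x = 0].
have Ss : S s by [].
have Sub : ubound S u by move=> x [].
have Sle x : S x -> x <= sup S by apply: ub_le_sup; exists u.
have Ssup : has_sup S by split; [exists s|exists u].
exists (sup S); split.
- exact: Sle.
- by apply: ge_sup => //; exists s.
- apply: contrapT => /eqP kS.
  have [e /= e0 he] : \forall x \near sup S, k x != 0.
    have := kc (sup S) => /cvgr_neq0; exact.
  have [x [xu kx] xS] := sup_adherent e0 Ssup.
  have xle : x <= sup S by apply: Sle.
  have := he x; rewrite /ball /= => /(_ _)/negP; apply; last exact/eqP.
  by rewrite ger0_norm; lra.
- move=> x Sx xu kx; have : x <= sup S by apply: Sle.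
  by lra.
Qed.

Lemma first_zero k s u : continuous k -> k s = 0 -> u <= s ->
  exists b, [/\ b <= s, u <= b, k b = 0 & forall x, u <= x -> x < b -> k x <> 0].
Proof.
move=> kc ks us.
have kNc : continuous (fun x => k (- x)).
  by move=> x; apply: continuous_comp; [exact: opp_continuous|exact: kc].
have [||a [sa au ka ha]] := @last_zero _ (- s) (- u) kNc; rewrite ?opprK//; first lra.
exists (- a); split=> //; try lra.
by move=> x ux xa; rewrite -(opprK x); apply: ha; lra.
Qed.

(** Subtracting the Taylor polynomials at [m] leaves functions with zero derivative inside the
    interval. They are constant up to the endpoints, so the formulas hold at [a] and [b] although
    [g] is affine only strictly between them. *)
Lemma cubic_of_affine_deriv2 f df g a b m s x :
  (forall t : R, is_derive t 1 f (df t)) -> (forall t : R, is_derive t 1 df (g t)) ->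
  (forall t, a < t -> t < b -> g t = g m + s * (t - m)) ->
  a < m -> m < b -> a <= x -> x <= b ->
  f x = f m + df m * (x - m) + g m / 2 * (x - m) ^+ 2 + s / 6 * (x - m) ^+ 3 /\
  df x = df m + g m * (x - m) + s / 2 * (x - m) ^+ 2.
Proof.
move=> fd dfd gaff am mb ax xb.
pose p t := df t - (df m + g m * (t - m) + s / 2 * (t - m) ^+ 2).
have pd (t : R) : is_derive t 1 p (g t - (g m + s * (t - m))).
  by apply: is_derive_eq; rewrite /GRing.scale /=; field.
pose q t := f t - (f m + df m * (t - m) + g m / 2 * (t - m) ^+ 2 + s / 6 * (t - m) ^+ 3).
have qd (t : R) : is_derive t 1 q (p t).
  by rewrite /p; apply: is_derive_eq; rewrite /GRing.scale /=; field.
have p0 t : a <= t -> t <= b -> p t = 0.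
  move=> aet teb; rewrite (is_derive0_constant pd _ am mb aet teb); first by rewrite /p; ring.
  by move=> z az zb; rewrite gaff// subrr.
have q0 : q x = 0.
  rewrite (is_derive0_constant qd _ am mb ax xb); first by rewrite /q; ring.
  by move=> z az zb; apply: p0; lra.
by split; [move: q0; rewrite /q; lra|have := p0 x ax xb; rewrite /p; lra].
Qed.

Lemma exprn_odd_homo p x y : odd p -> x <= y -> x ^+ p <= y ^+ p.
Proof.
move=> op xy; have [x0|x0] := leP 0 x.
  by rewrite ler_pXn2r// ?nnegrE//; [case: p op|lra].
have [y0|y0] := leP 0 y.
  by apply: (@le_trans _ _ 0); [rewrite exprn_odd_le0// ltW|rewrite exprn_ge0].
have oN (z : R) : (- z) ^+ p = - z ^+ p.
  by rewrite (exprNn z) -signr_odd op expr1 mulN1r.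
rewrite -lerN2 -!oN ler_pXn2r// ?nnegrE; try lra.
by case: p op {oN}.
Qed.

End RealCalculus.

(** * Arithmetic core of the gap estimates *)

Lemma le_of_mul_le (R : realFieldType) (a d K M : R) : 1 <= K -> 1 <= M ->
  0 <= a -> 1 / 12 <= d -> a * d <= 12 * M -> a <= 450 * K * M.
Proof.
move=> K1 M1 a0 d12 ad.
have q1 : a * (1 / 12) <= a * d by rewrite ler_wpM2l.
have q2 : M <= K * M by rewrite ler_peMl//; lra.
by rewrite -mulrA; lra.
Qed.

(** The line at [x1], read at [x2], bounds [F1] above by [16 * K]; read at 0, it then bounds [g0]
    below by [- 7 * K]. The line at 0, read at [x1] and at [y], bounds [F0] on both sides; the sign
    of [F0] decides which of the two bounds [g0] above. *)
Lemma support_lines_bound (R : realFieldType) (y x1 x2 g0 gy g1 g2 F0 F1 K : R) :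
  - (3 / 4) <= y -> y <= - (1 / 2) -> 1 / 8 <= x1 -> x1 <= 3 / 8 ->
  1 / 2 <= x2 -> x2 <= 3 / 4 ->
  g0 + F0 * y <= gy -> g0 + F0 * x1 <= g1 -> g1 + F1 * (- x1) <= g0 ->
  g1 + F1 * (x2 - x1) <= g2 -> `|gy| <= K -> `|g1| <= K -> `|g2| <= K ->
  `|g0| <= 64 * K /\ `|F0| <= 64 * K.
Proof.
move=> y01 y02 x11 x12 x21 x22 s0 s1 s2 s3.
rewrite !ler_norml => /andP[y0a y0b] /andP[x1a x1b] /andP[x2a x2b].
have K0 : 0 <= K by lra.
have F1le : F1 <= 16 * K by nra.
have g0a : - (7 * K) <= g0 by nra.
have F0a : F0 <= 64 * K by nra.
have F0b : - (16 * K) <= F0 by nra.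
have g0b : g0 <= K by have [F0'|F0'] := leP 0 F0; nra.
by split; apply/andP; split; lra.
Qed.

(** [A], [B], [G], [C] are the value and derivatives at the midpoint of the cubic with end values
    [ha], [hb] and end slopes [h1a], [h1b]; [b1], [b2], [f3] are mean slopes. The Hermite midpoint
    formula is exact for cubics ([herm]). In the first bound [X] contributes [r * S] through its
    values and [r * S / 2] through its slopes. *)
Lemma gap_hermite_bounds (R : realFieldType)
    (r S A B G C ha hb h1a h1b Xa Xm Xb ba bb b1 b2 fa fm fb fa1 fb1 f3 : R) :
  0 < r -> ha = A + B * (- r) + G / 2 * (- r) ^+ 2 + C / 6 * (- r) ^+ 3 ->
  hb = A + B * r + G / 2 * r ^+ 2 + C / 6 * r ^+ 3 ->
  h1a = B + G * (- r) + C / 2 * (- r) ^+ 2 -> h1b = B + G * r + C / 2 * r ^+ 2 ->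
  ha = Xa + fa -> hb = Xb + fb -> h1a = ba + fa1 -> h1b = bb + fb1 -> Xm + fm <= A ->
  Xm - Xa = b1 * r -> Xb - Xm = b2 * r -> fb - fa = f3 * (2 * r) ->
  fa1 <= f3 -> f3 <= fb1 ->
  `|ba| <= S -> `|bb| <= S -> `|b1| <= S -> `|b2| <= S ->
  [/\ fm - (fa + fb) / 2 + r / 4 * (fb1 - fa1) <= 3 / 2 * (r * S),
      `|G| * (2 * r) <= 2 * S + (fb1 - fa1) &
      `|C| * r ^+ 2 <= 3 / 2 * (4 * S + (fb1 - fa1))].
Proof.
move=> r0 haE hbE h1aE h1bE hXa hXb hba hbb mA e1 e2 e3 f13 f31.
rewrite !ler_norml => /andP[ba1 ba2] /andP[bb1 bb2] /andP[b11 b12] /andP[b21 b22].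
have herm : A - (ha + hb) / 2 + r / 4 * (h1b - h1a) = 0.
  by rewrite haE hbE h1aE h1bE; field.
have GE : G * (2 * r) = bb - ba + (fb1 - fa1).
  have -> : G * (2 * r) = h1b - h1a by rewrite h1aE h1bE; ring.
  by rewrite hba hbb; ring.
have CE : C * r ^+ 2 * (2 / 3) = ba + bb - (b1 + b2) + (fa1 + fb1 - 2 * f3).
  apply: (mulfI (lt0r_neq0 r0)).
  have -> : r * (C * r ^+ 2 * (2 / 3)) = r * (h1a + h1b) - (hb - ha).
    by rewrite haE hbE h1aE h1bE; field.
  have -> : hb - ha = (Xb - Xm) + (Xm - Xa) + (fb - fa) by rewrite hXa hXb; ring.
  by rewrite e1 e2 e3 hba hbb; ring.
split.
- have q : r / 4 * (h1b - h1a) = r / 4 * (bb - ba) + r / 4 * (fb1 - fa1).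
    by rewrite hba hbb; ring.
  have q1 : - (r * S) <= b1 * r by rewrite (mulrC b1) -mulrN ler_pM2l.
  have q2 : b2 * r <= r * S by rewrite (mulrC b2) ler_pM2l.
  have q3 : r * (- (2 * S)) <= r * (bb - ba) by rewrite ler_pM2l//; lra.
  by move: {f13 f31 GE CE e3 haE hbE h1aE h1bE} herm; rewrite q; lra.
- have -> : `|G| * (2 * r) = `|G * (2 * r)| by rewrite normrM (@gtr0_norm _ (2 * r))//; lra.
  by rewrite GE ler_norml; apply/andP; split; lra.
- have -> : `|C| * r ^+ 2 = `|C * r ^+ 2| by rewrite normrM (@ger0_norm _ (r ^+ 2)) ?sqr_ge0.
  by rewrite ler_norml; apply/andP; split; lra.
Qed.

(** For [r >= 1] the cubic lower bound on [D] meets an upper bound linear in [r], whence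
    [r ^+ 2 <= 33 * K * M]. *)
Lemma gap_length_bound (R : realFieldType) (K M r S D : R) : 1 <= K -> 1 <= M -> 0 < r ->
  S = M * (1 + 21 * r) -> D <= 3 / 2 * (K * S) -> (1 <= r -> r ^+ 3 <= D) ->
  2 * r <= 66 * K * M.
Proof.
move=> K1 M1 r0 SE DS Dge; have KM : 1 <= K * M by nra.
have [r1|r1] := leP 1 r; last by lra.
have S22 : S <= 22 * (M * r) by rewrite SE; nra.
have KS : K * S <= K * (22 * (M * r)) by rewrite ler_wpM2l//; lra.
have r2 : r ^+ 2 <= 33 * K * M.
  rewrite -(ler_pM2l r0) -exprS; apply: (le_trans (Dge r1)); apply: (le_trans DS).
  have -> : r * (33 * K * M) = 3 / 2 * (K * (22 * (M * r))) by field.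
  by rewrite ler_pM2l//; lra.
have : r <= r ^+ 2 by rewrite expr2 ler_peMl//; lra.
by lra.
Qed.

(** The lower bound [r >= 1 / 24] turns [S] into at most [45 * M * r], so that one can divide by
    [r]; then [450 = 10 * 45]. *)
Lemma gap_value_bound (R : realFieldType) (K M r S D G A z : R) :
  1 <= K -> 1 <= M -> 0 < r -> 1 <= 24 * r -> S = M * (1 + 21 * r) ->
  D <= 3 / 2 * (K * S) -> G * (2 * r) <= 2 * S + D ->
  A * r ^+ 2 <= 3 / 2 * (4 * S + D) -> 0 <= A -> z <= r ->
  G + A * z <= 450 * K * M.
Proof.
move=> K1 M1 r0 r24 SE DS G1 A2 A0 zr.
have SM : S <= 45 * (M * r) by rewrite SE; nra.
have S0 : 0 <= S by rewrite SE mulr_ge0//; lra.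
have KS : S <= K * S by rewrite ler_peMl.
have KM : K * S <= K * (45 * (M * r)) by rewrite ler_wpM2l//; lra.
have Az : A * z * r <= A * r ^+ 2.
  by rewrite expr2 mulrA ler_pM2r// ler_wpM2l.
rewrite -(ler_pM2r r0) mulrDl.
have -> : 450 * K * M * r = 10 * (K * (45 * (M * r))) by ring.
lra.
Qed.

(** * Deterministic estimates on intervals free of touch points *)

Section GapEstimates.
Context {R : realType} (h h1 g F X beta : R -> R) (n : nat) (M : R).
Context (hD : forall t : R, is_derive t 1 h (h1 t)).
Context (h1D : forall t : R, is_derive t 1 h1 (g t)).
Context (XD : forall t : R, is_derive t 1 X (beta t)).
Context (X0 : X 0 = 0).
Context (beta_le : forall t : R, `|beta t| <= M * (1 + `|t|)).
Context (M1 : 1 <= M).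
Context (n_even : ~~ odd n) (n4 : (4 <= n)%N).
Context (h_ge : forall t : R, X t + t ^+ n <= h t).
Context (g_support : forall x z : R, g x + F x * (z - x) <= g z).

Definition touch (x : R) := h x = X x + x ^+ n.

Context (F_const : forall x z : R, x <= z ->
  (forall s, x < s -> s <= z -> ~ touch s) -> F x = F z).

Let f1 (t : R) := n%:R * t ^+ n.-1.
Let y (t : R) := X t + t ^+ n.
Let y1 (t : R) := beta t + f1 t.

Let powD (t : R) : is_derive t 1 (fun s : R => s ^+ n) (f1 t).
Proof.
have := is_deriveX n (is_derive_id t (1 : R)).
by rewrite exprfctE /GRing.scale /= mulr1.
Qed.

Let yD (t : R) : is_derive t 1 y (y1 t).
Proof. by have := XD t; have := powD t => ? ?; exact: is_deriveD. Qed.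

Let kD (t : R) : is_derive t 1 (fun s => h s - y s) (h1 t - y1 t).
Proof. by have := hD t; have := yD t => ? ?; exact: is_deriveB. Qed.

Let kC : continuous (fun s => h s - y s).
Proof. exact: is_derive_continuous kD. Qed.

Let touchE x : (h x - y x = 0) <-> touch x.
Proof. by rewrite /touch -/(y x); split; lra. Qed.

(** A touch point is a minimum of the nonnegative function [h - y]. *)
Lemma touch_deriv x : touch x -> h1 x = beta x + n%:R * x ^+ n.-1.
Proof.
move=> tx; have h0 : is_derive x 1 (fun s => h s - y s) 0.
  apply: (@derive1_at_min _ _ (x - 1) (x + 1)); first lra.
  - by move=> t _; have [] := kD t.
  - by rewrite in_itv/=; lra.
  - by move=> t _; rewrite (proj2 (touchE x) tx) subr_ge0 h_ge.
have := @derive_val _ _ _ _ _ _ _ (kD x); rewrite (@derive_val _ _ _ _ _ _ _ h0).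
by rewrite /y1 /f1; lra.
Qed.

(** The supporting lines at [m] and at [t] have the same slope there, so each support inequality is
    the reverse of the other. *)
Lemma affine_off_touch a b m t : (forall s, a < s -> s < b -> ~ touch s) ->
  a < m -> m < b -> a < t -> t < b -> g t = g m + F m * (t - m).
Proof.
move=> nt am mb at_ tb; have e1 := g_support m t; have e2 := g_support t m.
have FE : F t = F m.
  have [mt|tm|->//] := ltgtP m t.
  - by rewrite (F_const (ltW mt))// => s ms st; apply: nt; lra.
  - by rewrite (F_const (ltW tm))// => s ms st; apply: nt; lra.
by move: e2; rewrite FE; nra.
Qed.

Let X_le t : `|X t| <= `|t| * (M * (1 + `|t|)).
Proof.
have M1' := M1; have [t0|t0|<-] := ltgtP 0 t; last by rewrite X0 !normr0 mul0r.
- have [c [c0 ct +]] := MVT_everywhere XD t0; rewrite X0 !subr0 => e; rewrite e.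
  rewrite normrM mulrC ler_wpM2l//; apply: (le_trans (beta_le c)).
  by rewrite (gtr0_norm c0) (gtr0_norm t0) ler_wpM2l//; lra.
- have [c [c0 ct +]] := MVT_everywhere XD t0; rewrite X0 => e.
  have -> : X t = beta c * t by lra.
  rewrite normrM mulrC ler_wpM2l//; apply: (le_trans (beta_le c)).
  by rewrite (ltr0_norm ct) (ltr0_norm t0) ler_wpM2l//; lra.
Qed.

(** For [|x| >= 1], [h x] is at least [|x|^4 - 2 * M * |x|^3], which no cubic can follow far out.
    Since [h] is a cubic wherever it does not touch, touch points exist on both sides of every
    point. *)
Lemma cubic_growth_bound m A B C D x : 1 <= `|x| ->
  h x = A + B * (x - m) + C * (x - m) ^+ 2 + D * (x - m) ^+ 3 ->
  `|x| <= `|A| + `|B| * (1 + `|m|) + `|C| * (1 + `|m|) ^+ 2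
          + `|D| * (1 + `|m|) ^+ 3 + 2 * M.
Proof.
move=> x1 hx; have M1' := M1; set p := 1 + `|m|; set z := `|x| in x1 *.
have xm : `|x - m| <= p * z.
  by apply: (le_trans (ler_normB _ _)); rewrite /p -/z; have := normr_ge0 m; nra.
have p0 : 0 <= p by rewrite /p addr_ge0.
have zge0 : 0 <= z by lra.
have xmn k : `|x - m| ^+ k <= p ^+ k * z ^+ k 
  by rewrite -exprMn lerXn2r ?nnegrE// mulr_ge0.
have z2 : 1 <= z ^+ 2 by rewrite exprn_ege1.
have z3 : 1 <= z ^+ 3 by rewrite exprn_ege1.
have z13 : z <= z ^+ 3 by rewrite exprS; nra.
have z23 : z ^+ 2 <= z ^+ 3 by rewrite exprS; nra.
have hle : h x <= (`|A| + `|B| * p + `|C| * p ^+ 2 + `|D| * p ^+ 3) * z ^+ 3.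
  rewrite hx !mulrDl; apply: lerD; [apply: lerD; [apply: lerD|]|].
  - by apply: (le_trans (ler_norm _)); rewrite ler_peMr.
  - apply: (le_trans (ler_norm _)); rewrite normrM -mulrA ler_wpM2l//.
    by apply: (le_trans xm); rewrite ler_wpM2l.
  - apply: (le_trans (ler_norm _)); rewrite normrM normrX -mulrA ler_wpM2l//.
    by apply: (le_trans (xmn 2%N)); rewrite ler_wpM2l// exprn_ge0.
  - by apply: (le_trans (ler_norm _)); rewrite normrM normrX -mulrA ler_wpM2l.
have powle : z ^+ 4 <= x ^+ n.
  have -> : x ^+ n = z ^+ n by rewrite -normrX ger0_norm// exprn_even_ge0.
  by rewrite ler_weXn2l.
have Xle : - X x <= 2 * M * z ^+ 3.
  have := X_le x; rewrite -/z ler_norml => /andP[+ _].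
  have : z * (M * (1 + z)) <= 2 * M * z ^+ 3 by nra.
  lra.
have := h_ge x; set K := (_ + `|D| * _) in hle * => hge.
have z0 : 0 < z ^+ 3 by lra.
rewrite -(ler_pM2r z0); have -> : z * z ^+ 3 = z ^+ 4 by rewrite -exprS.
lra.
Qed.

Let K3 m : R := `|h m| + `|h1 m| * (1 + `|m|) + `|g m / 2| * (1 + `|m|) ^+ 2
          + `|F m / 6| * (1 + `|m|) ^+ 3 + 2 * M.

Let no_touch_bounded a b m x : (forall s, a < s -> s < b -> ~ touch s) ->
  a < m -> m < b -> a <= x -> x <= b -> 1 <= `|x| -> `|x| <= K3 m.
Proof.
move=> nt am mb ax xb x1.
have gaff t : a < t -> t < b -> g t = g m + F m * (t - m).
  by move=> at_ tb; exact: affine_off_touch nt _ _ _ _.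
have [hx _] := cubic_of_affine_deriv2 hD h1D gaff am mb ax xb.
exact: cubic_growth_bound hx.
Qed.

Lemma touch_right u : exists2 x, u < x & touch x.
Proof.
apply: contrapT => nt; pose m := u + 1; pose x := `|u| + `|K3 m| + 2.
have := ler_norm u; have := ler_norm (K3 m); have := normr_ge0 u; have := normr_ge0 (K3 m).
move=> h1' h2 h3 h4; have x0 : 0 <= x by rewrite /x; lra.
have : `|x| <= K3 m.
  apply: (@no_touch_bounded u (x + 1)); rewrite ?ger0_norm// /m /x; try lra.
  by move=> s us _ ts; apply: nt; exists s.
by rewrite ger0_norm// /x; lra.
Qed.

Lemma touch_left u : exists2 x, x < u & touch x.
Proof.
apply: contrapT => nt; pose m := u - 1; pose x := - (`|u| + `|K3 m| + 2).
have := ler_norm (- u); rewrite normrN.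
have := ler_norm (K3 m); have := normr_ge0 u; have := normr_ge0 (K3 m).
move=> h1' h2 h3 h4; have x0 : x <= 0 by rewrite /x; lra.
have : `|x| <= K3 m.
  apply: (@no_touch_bounded (x - 1) u); rewrite ?ler0_norm// /m /x; try lra.
  by move=> s _ us ts; apply: nt; exists s.
by rewrite ler0_norm// /x; lra.
Qed.

Lemma gap_around u v : u <= v -> (forall s, u <= s -> s <= v -> ~ touch s) ->
  exists a b, [/\ a < u, v < b, touch a, touch b &
    forall s, a < s -> s < b -> ~ touch s].
Proof.
move=> uv nt; have [p pu /touchE tp] := touch_left u.
have [q vq /touchE tq] := touch_right v.
have [a [pa au ka na]] := last_zero kC tp (ltW pu).
have [b [bq vb kb nb]] := first_zero kC tq (ltW vq).
exists a, b; split; try exact/touchE.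
- by rewrite lt_neqAle au andbT; apply/eqP => e; apply: (nt u) => //; rewrite -e; exact/touchE.
- by rewrite lt_neqAle vb andbT; apply/eqP => e; apply: (nt v) => //; rewrite e; exact/touchE.
- move=> s as_ sb ts; have [su|us] := leP s u; first by apply: (na s) => //; exact/touchE.
  have [sv|vs] := leP s v; first by apply: (nt s) => //; exact: ltW.
  by apply: (nb s) => //; [exact: ltW|exact/touchE].
Qed.

(** The Hermite formula for [h] bounds the midpoint error of [t^n] above, and [hermite_error_power]
    bounds it below by a multiple of the derivative gap [D]. Together they give
    [D <= 3 / 2 * (K * S)], from which both conclusions follow. *)
Lemma gap_bounds a b : a < b -> touch a -> touch b ->
  (forall s, a < s -> s < b -> ~ touch s) -> `|a + b| <= 20 * (b - a) ->
  b - a <= 66 * hermite_const * M /\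
  (1 <= 12 * (b - a) -> forall x, a < x -> x < b -> `|g x| <= 450 * hermite_const * M).
Proof.
move=> ab ta tb nt abr; have M1' := M1.
pose m := (a + b) / 2; pose r := (b - a) / 2.
have r0 : 0 < r by rewrite /r; lra.
have aE : a = m - r by rewrite /m /r; lra.
have bE : b = m + r by rewrite /m /r; lra.
have [rE mE] : 2 * r = b - a /\ 2 * m = a + b by rewrite /m /r; split; field.
clearbody m r.
have mr : `|m| <= 20 * r.
  have -> : 20 * r = 10 * (b - a) by rewrite -rE; ring.
  by move: abr; rewrite -mE normrM (@gtr0_norm _ 2)//; lra.
(* On the gap [|t| <= |m| + r <= 21 * r], so [S] bounds [beta] there. *)
pose S := M * (1 + 21 * r).
have betaS t : a <= t -> t <= b -> `|beta t| <= S.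
  move=> at_ tb'; apply: (le_trans (beta_le t)); rewrite ler_wpM2l//; first lra.
  by move: mr; rewrite lerD2l !ler_norml => /andP[? ?]; apply/andP; split; lra.
have am : a < m by lra.
have mb : m < b by lra.
have gaff t : a < t -> t < b -> g t = g m + F m * (t - m).
  by move=> at_ tb'; exact: affine_off_touch nt _ _ _ _.
have [ha h1a] := cubic_of_affine_deriv2 hD h1D gaff am mb (lexx a) (ltW ab).
have [hb h1b] := cubic_of_affine_deriv2 hD h1D gaff am mb (ltW ab) (lexx b).
have K1 := @hermite_const_ge1 R; set K := hermite_const in K1 *.
have [c1 [ac1 c1m e1]] := MVT_everywhere XD am.
have [c2 [mc2 c2b e2]] := MVT_everywhere XD mb.
have ya1 := touch_deriv ta; have yb1 := touch_deriv tb.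
have herm := hermite_error_power n_even n4 r0 mr.
have fm := h_ge m.
have [c3 [ac3 c3b e3]] := MVT_everywhere powD ab.
have on1 : odd n.-1 by case: n n_even n4 => //= k; rewrite negbK.
have f1mono s t : s <= t -> f1 s <= f1 t.
  by move=> st; rewrite /f1 ler_wpM2l// exprn_odd_homo.
have fa3 := f1mono _ _ (ltW ac3); have f3b := f1mono _ _ (ltW c3b).
have Dge (r1 : 1 <= r) := deriv_power_gap_ge m n_even n4 r1.
rewrite -/K -aE -bE -/(f1 a) -/(f1 b) in herm Dge.
rewrite -/(f1 a) in ya1; rewrite -/(f1 b) in yb1.
rewrite /touch in ta tb.
have am' : a - m = - r by rewrite aE; ring.
have bm' : b - m = r by rewrite bE; ring.
have ma' : m - a = r by rewrite aE; ring.
have ba' : b - a = 2 * r by rewrite aE bE; ring.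
rewrite am' in ha h1a; rewrite bm' in hb h1b e2; rewrite ma' in e1; rewrite ba' in e3 *.
set D := f1 b - f1 a in herm Dge.
have bc1 := betaS c1 (ltW ac1) (ltW (lt_trans c1m mb)).
have bc2 := betaS c2 (ltW (lt_trans am mc2)) (ltW c2b).
have [hermX G1 G2] := gap_hermite_bounds r0 ha hb h1a h1b ta tb ya1 yb1 fm e1 e2 e3
  fa3 f3b (betaS a (lexx a) (ltW ab)) (betaS b (ltW ab) (lexx b)) bc1 bc2.
have {}hermX := le_trans herm hermX.
have DS : D <= 3 / 2 * (K * S).
  rewrite -(ler_pM2l r0).
  have K0 : 0 < K by exact: lt_le_trans ltr01 K1.
  have -> : r * D = K * (r / K * D) by rewrite mulrA [K * _]mulrCA divff ?gt_eqF// mulr1.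
  rewrite [r * (_ * _)]mulrCA [r * (K * S)]mulrCA mulrCA.
  by rewrite ler_pM2l.
have rM := gap_length_bound K1 M1' r0 erefl DS Dge.
split=> //.
move=> r24 x ax xb.
rewrite (gaff x ax xb).
have xm : `|x - m| <= r by rewrite ler_norml -am' -bm' !lerD2r !ltW.
apply: (le_trans (ler_normD _ _)); rewrite normrM.
apply: (gap_value_bound K1 M1' r0 _ erefl DS G1 G2) => //.
by move: r24; rewrite mulrA -natrM.
Qed.

(** Since 0 may itself be a touch point, the gap is taken around [[t / 2, t]]. Its left end is then
    at most 0 and its right end exceeds [t], so its length bounds [t]. *)
Lemma first_touch_right t : 0 < t -> (forall s, 0 < s -> s <= t -> ~ touch s) ->
  t <= 66 * hermite_const * M.
Proof.
move=> t0 nt; have [||a [b [at2 tb ta tb' nab]]] := @gap_around (t / 2) t; first by lra.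
  by move=> s s0 st; apply: nt; lra.
have a0 : a <= 0 by rewrite leNgt; apply/negP => a0; apply: (nt a) => //; lra.
have ab : a < b by lra.
have abr : `|a + b| <= 20 * (b - a) by rewrite ler_norml; apply/andP; split; lra.
have [+ _] := gap_bounds ab ta tb' nab abr.
by apply: le_trans; lra.
Qed.

Lemma first_touch_left t : 0 < t -> (forall s, - t <= s -> s < 0 -> ~ touch s) ->
  t <= 66 * hermite_const * M.
Proof.
move=> t0 nt; have [||a [b [at2 tb ta tb' nab]]] := @gap_around (- t) (- t / 2); first by lra.
  by move=> s s0 st; apply: nt; lra.
have b0 : 0 <= b by rewrite leNgt; apply/negP => b0; apply: (nt b) => //; lra.
have ab : a < b by lra.
have abr : `|a + b| <= 20 * (b - a) by rewrite ler_norml; apply/andP; split; lra.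
have [+ _] := gap_bounds ab ta tb' nab abr.
by apply: le_trans; lra.
Qed.

Let Kg : R := 450 * hermite_const * M.

(** The surrounding gap satisfies [a < 2 / 3], [b > - (2 / 3)] and [b - a > 1 / 12], hence [|a + b|
    <= (b - a) + 4 / 3 <= 20 * (b - a)]. The factor 20 in [gap_bounds] is sized for this case. *)
Let no_touch_window v : - (3 / 4) <= v -> v <= 2 / 3 ->
  (forall s, v <= s -> s <= v + 1 / 12 -> ~ touch s) -> `|g v| <= Kg.
Proof.
move=> v1 v2 nt; have [||a [b [av vb ta tb nab]]] := @gap_around v (v + 1 / 12) => //.
  by lra.
have ab : a < b by lra.
have abr : `|a + b| <= 20 * (b - a) by rewrite ler_norml; apply/andP; split; lra.
have [_ ->] := gap_bounds ab ta tb nab abr => //; lra.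
Qed.

Let deriv_at_touch c : touch c -> `|c| <= 3 / 4 -> `|h1 c| <= 6 * M.
Proof.
move=> tc c34; have M1' := M1; rewrite (touch_deriv tc).
apply: (le_trans (ler_normD _ _)).
have b1 : `|beta c| <= M * (7 / 4).
  by apply: (le_trans (beta_le c)); rewrite ler_wpM2l; lra.
(* The shift by 4 makes the left side nonincreasing from [p = 0] on, because
   [(p + 5) * 3 / 4 <= p + 4]; this is the uniformity in [n]. *)
have p4 p : (p%:R + 4) * (3 / 4) ^+ p <= 4 :> R.
  elim: p => [|p IH]; first by rewrite expr0; lra.
  rewrite exprS -(natr1 p); have : 0 <= (3 / 4) ^+ p :> R by rewrite exprn_ge0.
  have : 0 <= p%:R :> R by rewrite ler0n.
  move: (p%:R) ((3 / 4) ^+ p) IH => P E; nra.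
have n1 : `|n%:R * c ^+ n.-1| <= 4.
  rewrite normrM normrX normr_nat; apply: le_trans (p4 n.-1).
  apply: ler_pM => //; last by rewrite lerXn2r// nnegrE.
  by rewrite -natrD ler_nat; case: n n4 => //= k _; rewrite addnS ltnS leq_addr.
by lra.
Qed.

Lemma bounded_value_in_window u : - (3 / 4) <= u -> u <= 1 / 2 ->
  exists x, [/\ u <= x, x <= u + 1 / 4 & `|g x| <= 450 * hermite_const * M].
Proof.
move=> u1 u2.
have [[c [uc cu tc]]|nt] := pselect (exists c, [/\ u <= c, c <= u + 1 / 12 & touch c]); last first.
  exists u; split; try lra; apply: no_touch_window; try lra.
  by move=> s us su ts; apply: nt; exists s.
have [[c' [uc' cu' tc']]|nt] :=
    pselect (exists c, [/\ u + 1 / 6 <= c, c <= u + 1 / 6 + 1 / 12 & touch c]); last first.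
  exists (u + 1 / 6); split; try lra; apply: no_touch_window; try lra.
  by move=> s us su ts; apply: nt; exists s.
have hc : `|h1 c| <= 6 * M.
  by apply: deriv_at_touch => //; rewrite ler_norml; apply/andP; split; lra.
have hc' : `|h1 c'| <= 6 * M.
  by apply: deriv_at_touch => //; rewrite ler_norml; apply/andP; split; lra.
have cc' : c < c' by lra.
have [x [cx xc' e]] := MVT_everywhere h1D cc'.
exists x; split; try lra.
have d0 : 0 < c' - c by lra.
apply: (@le_of_mul_le _ _ (c' - c)) => //; [exact: hermite_const_ge1|lra|].
rewrite -[X in _ * X](gtr0_norm d0) -normrM -e.
by apply: (le_trans (ler_normB _ _)); lra.
Qed.

Lemma derivs_at0_bound : `|g 0| <= 64 * (450 * hermite_const * M) /\
  `|F 0| <= 64 * (450 * hermite_const * M).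
Proof.
(* One window lies left of 0 and two lie right of it, kept [1 / 8] away from 0 and from each
   other. *)
have Wy0 := @bounded_value_in_window (- (3 / 4)) ltac:(lra) ltac:(lra).
have Wx1 := @bounded_value_in_window (1 / 8) ltac:(lra) ltac:(lra).
have Wx2 := @bounded_value_in_window (1 / 2) ltac:(lra) ltac:(lra).
have [y0 [y01 y02 y0K]] := Wy0.
have [x1 [x11 x12 x1K]] := Wx1.
have [x2 [x21 x22 x2K]] := Wx2.
have s0 := g_support 0 y0; have s1 := g_support 0 x1; have s2 := g_support x1 0.
have s3 := g_support x1 x2; rewrite !subr0 in s0 s1; rewrite sub0r in s2.
by apply: support_lines_bound s0 s1 s2 s3 y0K x1K x2K; lra.
Qed.

End GapEstimates.

(** * The right derivative of a convex function is a subgradient *)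

Section ConvexRightDerivative.
Context {R : realType} (f : R -> R).
Context (fconv : convex_fun f).

Lemma convex_fun_chord u v w : u < v -> v < w ->
  (w - u) * f v <= (w - v) * f u + (v - u) * f w.
Proof.
move=> uv vw; have uw : 0 < w - u by lra.
have uw0 : w - u != 0 by rewrite gt_eqF.
pose l := (w - v) / (w - u).
have l0 : 0 <= l by rewrite divr_ge0//; lra.
have l1 : l <= 1 by rewrite ler_pdivrMr//; lra.
have := fconv u w l0 l1.
have -> : l * u + (1 - l) * w = v by rewrite /l; field.
rewrite -(ler_pM2l uw) => h; apply: (le_trans h).
by rewrite le_eqVlt; apply/orP; left; apply/eqP; rewrite /l; field.
Qed.

Let q x e := (f (x + e) - f x) / e.

Let q_homo x e e' : 0 < e -> e <= e' -> q x e <= q x e'.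
Proof.
move=> e0; rewrite le_eqVlt => /predU1P[->//|ee].
have e'0 : 0 < e' by lra.
have [] : x < x + e /\ x + e < x + e' by split; lra.
move=> h1 h2; have := convex_fun_chord h1 h2.
rewrite /q ler_pdivrMr// mulrAC ler_pdivlMr//.
have -> : x + e' - x = e' by ring.
have -> : x + e - x = e by ring.
have -> : x + e' - (x + e) = e' - e by ring.
lra.
Qed.

Let q_ge x e z : 0 < e -> z < x -> (f x - f z) / (x - z) <= q x e.
Proof.
move=> e0 zx; have xe : x < x + e by lra.
have := convex_fun_chord zx xe.
rewrite /q ler_pdivrMr ?subr_gt0// mulrAC ler_pdivlMr//.
have -> : x + e - x = e by ring.
by lra.
Qed.

Let q_cvg x : cvg (q x e @[e --> 0^'+]).
Proof.
apply: nondecreasing_at_right_is_cvgr.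
- near=> y => a b; rewrite !in_itv/= => /andP[a0 _] /andP[b0 _] ab.
  exact: q_homo.
- near=> y; exists ((f x - f (x - 1)) / (x - (x - 1))) => _ [e + <-].
  by rewrite /= in_itv/= => /andP[e0 _]; apply: q_ge; lra.
Unshelve. all: by end_near. Qed.

(** Right difference quotients decrease as the step shrinks and stay above every left quotient. So
    the limit in [rderiv] exists and lies between left and right slopes. *)
Lemma rderiv_support x z : f x + rderiv f x * (z - x) <= f z.
Proof.
have [xz|zx|->] := ltgtP x z; last by rewrite subrr mulr0 addr0.
- have : rderiv f x <= q x (z - x).
    apply: limr_le; first exact: q_cvg.
    near=> e; apply: q_homo; first by near: e; exact: nbhs_right_gt.
    by near: e; apply: nbhs_right_le; lra.
  rewrite /q ler_pdivlMr ?subr_gt0//.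
  have -> : x + (z - x) = z by ring.
  by lra.
- have : (f x - f z) / (x - z) <= rderiv f x.
    apply: limr_ge; first exact: q_cvg.
    near=> e; apply: q_ge => //; near: e; exact: nbhs_right_gt.
  rewrite ler_pdivrMr ?subr_gt0//; lra.
Unshelve. all: by end_near. Qed.

End ConvexRightDerivative.

(** * Stieltjes measures and vanishing integrals *)

Lemma stieltjes_itvoc (R : realType) (F : cumulative R R) (a b : R) : a <= b ->
  lebesgue_stieltjes_measure F `]a, b] = (F b - F a)%:E.
Proof.
move=> ab; rewrite /lebesgue_stieltjes_measure /measure_extension.
rewrite measurable_mu_extE/=; last exact: is_ocitv.
by rewrite wlength_itv_bnd// EFinB.
Qed.

(** A nonnegative function with zero integral vanishes almost everywhere, so []a, b]], where [k] has
    no zero, is a null set; its mass is [F b - F a]. *)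
Lemma cumulative_eq_of_integral_eq0 (R : realType) (F : cumulative R R) (k : R -> R) (a b : R) :
  continuous k -> (forall x, 0 <= k x) ->
  (\int[lebesgue_stieltjes_measure F]_x (k x)%:E = 0)%E ->
  a <= b -> (forall s, a < s -> s <= b -> k s <> 0) -> F a = F b.
Proof.
move=> kc k0 intk ab kn0.
have mk : measurable_fun setT (fun x : g_sigma_algebraType R.-ocitv.-measurable => (k x)%:E).
  by apply/measurable_EFinP; exact: continuous_measurable_fun.
have : (\int[lebesgue_stieltjes_measure F]_x `|(k x)%:E| = 0)%E.
  by rewrite -intk; apply: eq_integral => x _; rewrite gee0_abs// lee_fin.
move=> /(ae_eq_integral_abs (lebesgue_stieltjes_measure F) measurableT mk).
move=> [N [mN N0 subN]].
have : (lebesgue_stieltjes_measure F `]a, b] <= lebesgue_stieltjes_measure F N)%E.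
  apply: le_measure; rewrite ?inE//.
  move=> s /=; rewrite in_itv/= => /andP[as_ sb]; apply: subN => /= /(_ Logic.I).
  by move=> /(congr1 fine) /=; exact: kn0.
rewrite stieltjes_itvoc// N0 lee_fin subr_le0 => Fba.
by apply/eqP; rewrite eq_le Fba andbT; exact: cumulative_is_nondecreasing.
Qed.

(** * Differentiability of the primitive based at 0 *)

Section PrimitiveFromZero.
Context {R : realType} (f : R -> R).
Context (fc : continuous f).
Let mu := @lebesgue_measure R.

Let f_integrable (a b : R) : mu.-integrable `[a, b] (EFin \o f).
Proof.
apply: continuous_compact_integrable; first exact: segment_compact.
exact: continuous_subspaceT.
Qed.

Let integral0_shift (a u : R) : a < 0 -> a < u ->
  Defs.integral0 f u = Rintegral mu `[a, u] f - Rintegral mu `[a, 0] f.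
Proof.
move=> a0 au; rewrite /Defs.integral0; case: leP => u0.
- rewrite (@Rintegral_itvB _ f (BLeft a) (BRight u) 0)//; last by rewrite bnd_simp; exact: ltW.
  rewrite Rintegral_itv_obnd_cbnd//; apply: integrableS (f_integrable 0 u) => //.
  by apply: subset_itvr; rewrite bnd_simp.
- rewrite -opprB (@Rintegral_itvB _ f (BLeft a) (BRight 0) u)//; last 2 first.
  + by rewrite bnd_simp; exact: ltW.
  + by rewrite bnd_simp; exact: ltW.
  rewrite Rintegral_itv_obnd_cbnd//; apply: integrableS (f_integrable u 0) => //.
  by apply: subset_itvr; rewrite bnd_simp.
Qed.

Lemma integral0_0 : Defs.integral0 f 0 = 0.
Proof. by rewrite /Defs.integral0 lexx set_itv1 Rintegral_set1. Qed.

Lemma is_derive_integral0 (x : R) : is_derive x 1 (Defs.integral0 f) (f x).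
Proof.
(* A base point left of both 0 and [x] avoids the sign split in [integral0]; the primitive changes
   only by a constant. *)
pose a : R := - `|x| - 1.
have xa : a < x by rewrite /a; have := ler_norm (- x); rewrite normrN; lra.
have a0 : a < 0 by rewrite /a; have := normr_ge0 x; lra.
have x1 : x < x + 1 by lra.
have [d1 d2] := continuous_FTC1_closed x1 (f_integrable a (x + 1)) xa (@fc x).
pose G (u : R) := Rintegral mu `[a, u] f - Rintegral mu `[a, 0] f.
have dG : is_derive x 1 G (f x).
  rewrite -[f x]subr0; apply: is_deriveB.
  by apply: DeriveDef; [exact: d1|rewrite -derive1E; exact: d2].
have nG : \forall u \near x, G u = Defs.integral0 f u.
  by near=> u; rewrite (@integral0_shift a)//; near: u; exact: lt_nbhsr.
exact: near_eq_is_derive nG dG.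
Unshelve. all: by end_near. Qed.

End PrimitiveFromZero.

(** * Gaussian tails and Brownian increments *)

Section GaussianTail.
Context {R : realType}.
Let mu := @lebesgue_measure R.

(** Exponential tilting by completing the square: the mean moves by [lambda * s ^+ 2]. *)
Lemma normal_pdf_tilt (s lambda u : R) : s != 0 ->
  normal_pdf 0 s u * expR (lambda * u) =
  expR (lambda ^+ 2 * s ^+ 2 / 2) * normal_pdf (lambda * s ^+ 2) s u.
Proof.
move=> s0; rewrite !normal_pdfE// /normal_fun [RHS]mulrCA -[LHS]mulrA -!expRD.
by congr (_ * expR _); field.
Qed.

(** On [A] the factor [exp(lambda * u - c)] is at least 1; inserting it gives a constant times a
    tilted normal probability, which is at most 1. *)
Lemma normal_prob_chernoff (s lambda c : R) (A : set R) : s != 0 -> measurable A ->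
  (forall u, A u -> c <= lambda * u) ->
  (normal_prob 0 s A <= (expR (- c + lambda ^+ 2 * s ^+ 2 / 2))%:E)%E.
Proof.
move=> s0 mA hA; pose E := expR (- c + lambda ^+ 2 * s ^+ 2 / 2).
have mpdf m : measurable_fun A (fun u => (normal_pdf m s u)%:E).
  apply/measurable_EFinP; apply: measurable_funTS; exact: measurable_normal_pdf.
apply: (@le_trans _ _ (E%:E * normal_prob (lambda * s ^+ 2) s A)%E); last first.
  rewrite -[leRHS]mule1 lee_wpmul2l//; first by rewrite lee_fin expR_ge0.
  exact: (@probability_le1 _ _ _ (normal_prob (lambda * s ^+ 2) s)).
rewrite /normal_prob -ge0_integralZl_EFin//; last 3 first.
- by move=> u _; rewrite lee_fin normal_pdf_ge0.
- exact: mpdf.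
- exact: expR_ge0.
apply: ge0_le_integral => //.
- by move=> u _; rewrite lee_fin normal_pdf_ge0.
- exact: mpdf.
- by apply: measurable_funeM; exact: mpdf.
- move=> u Au; rewrite -EFinM lee_fin.
  have tilt := normal_pdf_tilt lambda u s0.
  rewrite /E expRD -[expR (- c) * _ * _]mulrA -tilt.
  rewrite mulrCA ler_peMr ?normal_pdf_ge0// -expRD -[leLHS]expR0 ler_expR.
  by have := hA u Au; lra.
Qed.

End GaussianTail.

Section IncrementTail.
Context {R : realType} {d : measure_display} {Omega : measurableType d}.
Context (P : probability Omega R) (B : R -> Omega -> R) (BM : two_sided_BM P B).

Lemma increment_distribution (s t : R) (A : set R) : s < t -> measurable A ->
  P [set w | A (B t w - B s w)] = normal_prob 0 (Num.sqrt (t - s)) A.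
Proof.
move=> st mA; have [_ _ /(_ 1%N (fun i => if i == 0%N then s else t) (fun=> A))] := BM.
rewrite big_ord_recl big_ord0 mule1 /= => <- //; last by case.
congr (P _); apply/seteqP; split=> w /=; first by move=> Aw [|//] _.
by move=> /(_ 0%N); apply.
Qed.

(** The parameter [lambda] stays free: it will be 1 at integer times and [(4 / 3) ^+ n] at dyadic
    level [n]. *)
Lemma increment_tail (s t z lambda : R) : s < t -> 0 <= lambda ->
  (P [set w | (z < `|B t w - B s w|)%R] <=
   (2 * expR (- (lambda * z) + lambda ^+ 2 * (t - s) / 2))%:E)%E.
Proof.
move=> st l0.
have ts0 : 0 < t - s by lra.
have q0 : Num.sqrt (t - s) != 0 by rewrite sqrtr_eq0 -ltNge.
have q2 : Num.sqrt (t - s) ^+ 2 = t - s by rewrite sqr_sqrtr ?ltW.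
have mA1 : measurable (`]z, +oo[%classic : set R) by [].
have mA2 : measurable (`]-oo, - z[%classic : set R) by [].
rewrite mulr2n mulrDl mul1r EFinD.
have [mB _ _] := BM.
have mD : measurable_fun setT (fun w => B t w - B s w) by apply: measurable_funB.
have mW (A : set R) : measurable A -> measurable [set w | A (B t w - B s w)].
  by move=> mA; rewrite -[X in measurable X]setTI; exact: mD.
have setE : [set w | z < `|B t w - B s w|] =
   [set w | `]z, +oo[%classic (B t w - B s w)] `|` [set w | `]-oo, - z[%classic (B t w - B s w)].
  apply/seteqP; split=> w /=; rewrite !in_itv/= andbT lter_normr.
    by move=> /orP[|?]; [left|right; lra].
  by move=> [?|?]; apply/orP; [left|right; lra].
rewrite setE; apply: (le_trans (measureU2 _ _ _)); [exact: (mW _ mA1)|exact: (mW _ mA2)|].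
have e1 := increment_distribution st mA1; have e2 := increment_distribution st mA2.
move: q0 q2 e1 e2; move: (Num.sqrt (t - s)) => sg q0 q2 e1 e2; rewrite -q2.
apply: leeD; [rewrite [leLHS]e1|rewrite [leLHS]e2].
- apply: normal_prob_chernoff => // u; rewrite /= in_itv/= andbT => zu.
  by rewrite ler_wpM2l// ltW.
- rewrite -(sqrrN lambda); apply: normal_prob_chernoff => // u.
  by rewrite /= in_itv/= => uz; rewrite mulNr -mulrN ler_wpM2l//; lra.
Qed.

End IncrementTail.

(** * Countable union bounds and dyadic chaining *)

Lemma measure_bigcup_geometric d (T : measurableType d) (R : realType)
    (mu : {measure set T -> \bar R}) (F : nat -> set T) (r : R) :
  0 <= r -> (forall n, measurable (F n)) ->
  (forall n, (mu (F n) <= (r / (2 ^ n.+1)%:R)%:E)%E) ->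
  (mu (\bigcup_n F n) <= r%:E)%E.
Proof.
move=> r0 mF muF; apply: le_trans (epsilon_trick0 xpredT r0).
apply: (@le_trans _ _ (\sum_(0 <= n <oo) mu (F n))%E).
  by apply: measure_sigma_subadditive => //; exact: bigcup_measurable.
by apply: lee_nneseries.
Qed.

Section DyadicChaining.
Context {R : realType}.

(* The thresholds telescope along a dyadic expansion: (2n+c)(3/4)^n = V(n-1) - V(n)
   with V(n) = (6n+24+3c)(3/4)^n. *)
Lemma dyadic_chain (z : R -> R) (x c a u : R) : continuous z -> 1 <= x -> 1 <= c ->
  0 <= u -> u < 1 ->
  (forall n i, (i < 2 ^ n)%N ->
    `|z (a + i.+1%:R / (2 ^ n)%:R) - z (a + i%:R / (2 ^ n)%:R)|
      <= x * (2 * n%:R + c) * (3 / 4) ^+ n) ->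
  `|z (a + u) - z a| <= x * (25 + 3 * c).
Proof.
move=> zc x1 c1 u0 u1 hz.
have chain n : exists i, [/\ (i < 2 ^ n)%N, i%:R / (2 ^ n)%:R <= u,
    u < i.+1%:R / (2 ^ n)%:R &
    `|z (a + i%:R / (2 ^ n)%:R) - z a| <=
      x * (24 + 3 * c - (6 * n%:R + 24 + 3 * c) * (3 / 4) ^+ n)].
  elim: n => [|n [i [i2 iu ui hi]]].
    exists 0%N; split => //; rewrite ?mul0r ?expn0 ?divr1//.
    by rewrite addr0 subrr normr0 expr0 mulr1 mulr0 add0r subrr mulr0.
  have p0 : 0 < (2 ^ n)%:R :> R by rewrite ltr0n expn_gt0.
  have pS : (2 ^ n.+1)%:R = 2 * (2 ^ n)%:R :> R by rewrite expnS natrM.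
  have dbl (k : nat) : k.*2%:R / (2 ^ n.+1)%:R = k%:R / (2 ^ n)%:R :> R.
    by rewrite pS -muln2 natrM; field; rewrite gt_eqF.
  have budget : x * (24 + 3 * c - (6 * n%:R + 24 + 3 * c) * (3 / 4) ^+ n) +
      x * (2 * n.+1%:R + c) * (3 / 4) ^+ n.+1 =
      x * (24 + 3 * c - (6 * n.+1%:R + 24 + 3 * c) * (3 / 4) ^+ n.+1).
    by rewrite exprS -natr1; field.
  have budget0 : 0 <= x * (2 * n.+1%:R + c) * (3 / 4) ^+ n.+1.
    rewrite mulr_ge0 ?exprn_ge0// mulr_ge0//; first lra.
    by rewrite addr_ge0 ?mulr_ge0//; lra.
  (* If [u] lies in the left half, the left endpoint is kept; otherwise it moves by one increment of
     level [n.+1], paid for by the budget. *)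
  have [ui1|ui1] := ltP u (i.*2.+1%:R / (2 ^ n.+1)%:R).
    exists i.*2; rewrite dbl; split => //; first by rewrite expnS mul2n ltn_double.
    by rewrite -budget; apply: (le_trans hi); rewrite lerDl.
  exists i.*2.+1; split => //; first by rewrite expnS mul2n -doubleS leq_double.
    by rewrite -doubleS dbl.
  have i22 : (i.*2 < 2 ^ n.+1)%N by rewrite expnS mul2n ltn_double.
  have := hz n.+1 i.*2 i22; rewrite dbl -budget => h.
  rewrite -(subrKA (z (a + i%:R / (2 ^ n)%:R))) addrC.
  by apply: (le_trans (ler_normD _ _)); exact: lerD.
(* Continuity closes the chain with an error below [1 <= x], which turns 24 into 25. *)
have /cvgrPdist_lt/(_ 1 ltr01)[e /= e0 he] := zc (a + u).
have [n hn] : exists n, 1 / (2 ^ n)%:R < e.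
  exists (Num.truncn e^-1).+1; rewrite div1r invf_plt ?posrE// ?ltr0n ?expn_gt0//.
  apply: (lt_le_trans (truncnS_gt _)); rewrite ler_nat ltnW// ltn_expl//.
have [i [i2 iu ui hi]] := chain n.
have p0 : 0 < (2 ^ n)%:R :> R by rewrite ltr0n expn_gt0.
have near1 : `|z (a + u) - z (a + i%:R / (2 ^ n)%:R)| < 1.
  apply: he; rewrite /ball /= (_ : _ - _ = u - i%:R / (2 ^ n)%:R); last by ring.
  rewrite ger0_norm ?subr_ge0//; apply: le_lt_trans hn.
  by move: ui; rewrite -natr1 mulrDl; lra.
rewrite -(subrKA (z (a + i%:R / (2 ^ n)%:R))).
apply: (le_trans (ler_normD _ _)).
have V0 : 0 <= (6 * n%:R + 24 + 3 * c) * (3 / 4) ^+ n.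
  rewrite mulr_ge0 ?exprn_ge0//; have : 0 <= n%:R :> R by rewrite ler0n.
  lra.
have : x * (24 + 3 * c - (6 * n%:R + 24 + 3 * c) * (3 / 4) ^+ n) <= x * (24 + 3 * c).
  by rewrite ler_wpM2l//; lra.
lra.
Qed.

End DyadicChaining.

Lemma expRN_nat_le (R : realType) (m : nat) : expR (- m%:R) <= ((2 ^ m)%:R)^-1 :> R.
Proof.
rewrite expRN lef_pV2 ?posrE ?expR_gt0 ?ltr0n ?expn_gt0//.
rewrite -[m%:R]mulr1 expRM_natl natrX lerXn2r ?nnegrE ?expR_ge0//.
by apply: le_trans (expR_ge1Dx 1).
Qed.

(** * Linear growth on the half-line off exceptional events *)

Section LinearGrowth.
Context {R : realType} {d : measure_display} {Omega : measurableType d}.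
Context (P : probability Omega R) (Z : R -> Omega -> R).
Context (mZ : forall t, measurable_fun setT (Z t)).
Context (tail : forall s t z lambda : R, 0 <= s -> s < t -> 0 <= lambda ->
  (P [set w | (z < `|Z t w - Z s w|)%R] <=
   (2 * expR (- (lambda * z) + lambda ^+ 2 * (t - s) / 2))%:E)%E).

Definition dyadic_exceedance (x : R) (k n i : nat) : set Omega :=
  [set w | x * (2 * n%:R + k.+1%:R) * (3 / 4) ^+ n <
     `|Z (k%:R + i.+1%:R / (2 ^ n)%:R) w - Z (k%:R + i%:R / (2 ^ n)%:R) w|].

(** The first event concerns the right end [k.+1] of the block, which is where the next block
    starts; block 0 starts from [Z 0]. *)
Definition block_exceedance (x : R) (k : nat) : set Omega :=
  [set w | 2 * x * k.+2%:R < `|Z k.+1%:R w - Z 0 w|] `|`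
  \bigcup_n \big[setU/set0]_(i < 2 ^ n) dyadic_exceedance x k n i.

Let measurable_exceed s t z : measurable [set w | z < `|Z t w - Z s w|].
Proof.
have mD : measurable_fun setT (fun w => `|Z t w - Z s w|).
  by apply: measurableT_comp => //; exact: measurable_funB.
have -> : [set w | z < `|Z t w - Z s w|] =
    setT `&` (fun w => `|Z t w - Z s w|) @^-1` `]z, +oo[%classic.
  by rewrite setTI; apply/seteqP; split=> w /=; rewrite in_itv/= andbT.
exact: mD.
Qed.

Let measurable_dyadic x k n :
  measurable (\big[setU/set0]_(i < 2 ^ n) dyadic_exceedance x k n i).
Proof. by apply: bigsetU_measurable => i _; exact: measurable_exceed. Qed.

Lemma measurable_block_exceedance x k : measurable (block_exceedance x k).
Proof.
apply: measurableU; first exact: measurable_exceed.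
by apply: bigcup_measurable => n _; exact: measurable_dyadic.
Qed.

(** The tilt [(4 / 3) ^+ n] cancels the decay of the threshold, and the variance term is
    [(8 / 9) ^+ n / 2 <= 1 / 2]. For [x >= 1] the rest splits off [exp(- x)] and a power of 2. *)
Lemma dyadic_exceedance_prob x k n i : 1 <= x ->
  (P (dyadic_exceedance x k n i) <=
   (2 * expR (1 / 2) * expR (- x) / (2 ^ (2 * n + k))%:R)%:E)%E.
Proof.
move=> x1; have p0 : 0 < (2 ^ n)%:R :> R by rewrite ltr0n expn_gt0.
pose s : R := k%:R + i%:R / (2 ^ n)%:R; pose t : R := k%:R + i.+1%:R / (2 ^ n)%:R.
have ts : t - s = ((2 ^ n)%:R)^-1.
  by rewrite /t /s -natr1; field; rewrite gt_eqF.
have s0 : 0 <= s by rewrite addr_ge0// divr_ge0// ltW.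
have st : s < t by rewrite -subr_gt0 ts invr_gt0.
have l0 : 0 <= (4 / 3 : R) ^+ n by rewrite exprn_ge0.
apply: le_trans (tail _ s0 st l0) _; rewrite lee_fin ts.
rewrite -!mulrA ler_wpM2l//.
apply: (@le_trans _ _ (expR (1 / 2 + (- x + - (2 * n + k)%:R)))); last first.
  rewrite !expRD ler_wpM2l ?expR_ge0// ler_wpM2l ?expR_ge0//.
  exact: expRN_nat_le.
rewrite ler_expR.
have e1 : (4 / 3) ^+ n * (x * ((2 * n%:R + k.+1%:R) * (3 / 4) ^+ n)) =
    x * (2 * n%:R + k.+1%:R) :> R.
  have e34 : (4 / 3) ^+ n * (3 / 4) ^+ n = 1 :> R.
    by rewrite -exprMn (_ : 4 / 3 * (3 / 4) = 1) ?expr1n//; field.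
  have -> : (4 / 3) ^+ n * (x * ((2 * n%:R + k.+1%:R) * (3 / 4) ^+ n)) =
    x * (2 * n%:R + k.+1%:R) * ((4 / 3) ^+ n * (3 / 4) ^+ n) :> R by ring.
  by rewrite e34 mulr1.
have e2 : (4 / 3) ^+ n ^+ 2 * ((2 ^ n)%:R)^-1 <= 1 :> R.
  rewrite exprAC natrX -exprVn -exprMn exprn_ile1//; lra.
have e3 : (4 / 3) ^+ n * ((4 / 3) ^+ n * (((2 ^ n)%:R)^-1 / 2)) =
    (4 / 3) ^+ n ^+ 2 * ((2 ^ n)%:R)^-1 / 2 :> R by ring.
rewrite e1 e3 natrD natrM -[k.+1%:R]natr1.
have n0 : 0 <= n%:R :> R by rewrite ler0n.
have k0 : 0 <= k%:R :> R by rewrite ler0n.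
move: e2 (n%:R) (k%:R) n0 k0; move: (_ * _^-1) => q e2 N K n0 k0.
have : 2 * N + K <= x * (2 * N + K) by rewrite ler_peMl//; lra.
have -> : x * (2 * N + (K + 1)) = x * (2 * N + K) + x by ring.
lra.
Qed.

(** The [2 ^ n] events of level [n] cost a factor [2 ^ n] against [2 ^ (2 * n + k)], which leaves a
    series geometric in [n]. *)
Lemma block_exceedance_prob x k : 1 <= x ->
  (P (block_exceedance x k) <=
   ((2 + 8 * expR (1 / 2)) * expR (- x) / (2 ^ k.+1)%:R)%:E)%E.
Proof.
move=> x1; have ex0 := @expR_ge0 R (- x); have eh0 := @expR_ge0 R (1 / 2).
apply: (le_trans (measureU2 _ _ _)); first exact: measurable_exceed.
  by apply: bigcup_measurable => n _; exact: measurable_dyadic.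
have -> : (2 + 8 * expR (1 / 2)) * expR (- x) / (2 ^ k.+1)%:R =
    2 * expR (- x) / (2 ^ k.+1)%:R + 8 * expR (1 / 2) * expR (- x) / (2 ^ k.+1)%:R by ring.
rewrite EFinD; apply: leeD.
- have k1 : 0 < k.+1%:R :> R by rewrite ltr0n.
  apply: le_trans (tail _ (lexx 0) k1 ler01) _; rewrite lee_fin -[leRHS]mulrA ler_wpM2l//.
  apply: (@le_trans _ _ (expR (- x + - k.+1%:R))); last first.
    by rewrite expRD ler_wpM2l// expRN_nat_le.
  rewrite ler_expR -[k.+2%:R]natr1 subr0; move: (k.+1%:R) k1 => K k1.
  by nra.
- pose r := 4 * expR (1 / 2) * expR (- x) / (2 ^ k)%:R : R.
  have -> : 8 * expR (1 / 2) * expR (- x) / (2 ^ k.+1)%:R = r.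
    by rewrite /r expnS natrM; field; rewrite gt_eqF// ltr0n expn_gt0.
  apply: measure_bigcup_geometric.
  + by rewrite /r !mulr_ge0// invr_ge0.
  + exact: measurable_dyadic.
  move=> n; apply: le_trans (le_mu_bigsetU _ _) _.
    by move=> i _; exact: measurable_exceed.
  apply: (@le_trans _ _ (\sum_(i < 2 ^ n)
      (2 * expR (1 / 2) * expR (- x) / (2 ^ (2 * n + k))%:R)%:E)%E).
    by apply: lee_sum => i _; exact: dyadic_exceedance_prob.
  rewrite sumEFin lee_fin sumr_const card_ord.
  rewrite le_eqVlt; apply/orP; left; apply/eqP; rewrite -[LHS]mulr_natl.
  have e1 : (2 ^ (2 * n + k))%:R = (2 ^ n)%:R ^+ 2 * (2 ^ k)%:R :> R.
    by rewrite expnD natrM (mulnC 2%N) expnM natrX.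
  have e2 : (2 ^ n.+1)%:R = 2 * (2 ^ n)%:R :> R by rewrite expnS natrM.
  have pk : (2 ^ k)%:R != 0 :> R by rewrite pnatr_eq0 -lt0n expn_gt0.
  have pn : (2 ^ n)%:R != 0 :> R by rewrite pnatr_eq0 -lt0n expn_gt0.
  rewrite /r e1 e2; move: ((2 ^ k)%:R) ((2 ^ n)%:R) pk pn => K N pk pn; field.
  by rewrite pk pn.
Qed.

Lemma linear_growth_off_blocks x w t : 1 <= x -> Z 0 w = 0 ->
  continuous (fun t => Z t w) -> (forall k, ~ block_exceedance x k w) -> 0 <= t ->
  `|Z t w| <= 30 * x * (1 + t).
Proof.
move=> x1 Z0 Zc good t0.
have [/andP[kt tk]] : ((Num.truncn t)%:R <= t < (Num.truncn t).+1%:R).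
  exact: truncn_itv.
move: (Num.truncn t) kt tk => k kt tk.
have Zk : `|Z k%:R w| <= 2 * x * k.+1%:R.
  case: k kt tk => [|k] kt tk; first by rewrite Z0 normr0 !mulr_ge0//; lra.
  rewrite leNgt; apply/negP => h; apply: (good k); left.
  by rewrite /= Z0 subr0.
have c1 : 1 <= k.+1%:R :> R by rewrite ler1n.
have chain : `|Z t w - Z k%:R w| <= x * (25 + 3 * k.+1%:R).
  rewrite -[X in Z X w - _](subrKC k%:R t).
  apply: (@dyadic_chain _ (fun t => Z t w)) => //.
  - by rewrite subr_ge0.
  - by rewrite ltrBlDl natr1.
  - move=> n i i2; rewrite leNgt; apply/negP => h; apply: (good k); right; exists n => //.
    by rewrite -bigcup_mkord; exists i.
have := ler_normD (Z t w - Z k%:R w) (Z k%:R w); rewrite subrK => h.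
(* With [K = k.+1 >= 1], [25 + 3 * K + 2 * K <= 30 * K]. *)
apply: (le_trans h); apply: (@le_trans _ _ (30 * x * k.+1%:R)).
  apply: (le_trans (lerD chain Zk)); move: (k.+1%:R) c1 => K c1; nra.
by rewrite ler_wpM2l//; [lra|rewrite -natr1; lra].
Qed.

End LinearGrowth.

(** * Linear growth of Brownian paths on the whole line *)

Section BrownianGrowth.
Context {R : realType} {d : measure_display} {Omega : measurableType d}.
Context (P : probability Omega R) (B : R -> Omega -> R) (BM : two_sided_BM P B).

Lemma BM_linear_growth (x : R) : 1 <= x ->
  exists E : set Omega, [/\ measurable E,
    (P E <= ((4 + 16 * expR (1 / 2)) * expR (- x))%:E)%E &
    forall w, ~ E w -> B 0 w = 0 -> continuous (fun t => B t w) ->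
      forall t, `|B t w| <= 30 * x * (1 + `|t|)].
Proof.
move=> x1; have [mB _ _] := BM.
(* Negative times are handled by time reversal, whose increments have the same tails; this doubles
   the constant. *)
pose B' t w := B (- t) w.
have mB' t : measurable_fun setT (B' t) by exact: mB.
have tail s t z lambda : 0 <= s -> s < t -> 0 <= lambda ->
    (P [set w | (z < `|B t w - B s w|)%R] <=
     (2 * expR (- (lambda * z) + lambda ^+ 2 * (t - s) / 2))%:E)%E.
  by move=> _ st l0; exact: (increment_tail BM z st l0).
have tail' s t z lambda : 0 <= s -> s < t -> 0 <= lambda ->
    (P [set w | (z < `|B' t w - B' s w|)%R] <=
     (2 * expR (- (lambda * z) + lambda ^+ 2 * (t - s) / 2))%:E)%E.
  move=> _ st l0; have st' : - t < - s by lra.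
  have := increment_tail BM z st' l0.
  rewrite (_ : - s - - t = t - s); last by ring.
  by under eq_set => w do rewrite distrC.
pose E := \bigcup_k block_exceedance B x k.
pose E' := \bigcup_k block_exceedance B' x k.
have c0 : 0 <= (2 + 8 * expR (1 / 2)) * expR (- x).
  by rewrite mulr_ge0 ?expR_ge0// addr_ge0// mulr_ge0// expR_ge0.
have mE : measurable E by apply: bigcup_measurable => k _; exact: measurable_block_exceedance.
have mE' : measurable E' by apply: bigcup_measurable => k _; exact: measurable_block_exceedance.
have PE : (P E <= ((2 + 8 * expR (1 / 2)) * expR (- x))%:E)%E.
  apply: measure_bigcup_geometric => // k; first exact: measurable_block_exceedance.
  exact: block_exceedance_prob.
have PE' : (P E' <= ((2 + 8 * expR (1 / 2)) * expR (- x))%:E)%E.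
  apply: measure_bigcup_geometric => // k; first exact: measurable_block_exceedance.
  exact: block_exceedance_prob.
exists (E `|` E'); split; first exact: measurableU.
- apply: (le_trans (measureU2 _ _ _)) => //; apply: (le_trans (leeD PE PE')).
  by rewrite -EFinD lee_fin le_eqVlt; apply/orP; left; apply/eqP; ring.
- move=> w nE B0 Bc t; have [t0|t0] := leP 0 t.
    rewrite (ger0_norm t0); apply: (linear_growth_off_blocks x1 B0 Bc) => // k bk.
    by apply: nE; left; exists k.
  have := @linear_growth_off_blocks _ _ _ B' x w (- t) x1.
  rewrite /B' oppr0 opprK (ltr0_norm t0); apply => //; last lra.
  + move=> s; apply: (@continuous_comp _ _ _ -%R (fun t => B t w)); last exact: Bc.
    exact: opp_continuous.
  + by move=> k bk; apply: nE; right; exists k.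
Qed.

End BrownianGrowth.

(** * Application of the gap estimates to the invelope *)

Lemma derivable_is_derive1 (R : realType) (f : R -> R) (x : R) :
  derivable f x 1 -> is_derive x 1 f (derive1 f x).
Proof. by rewrite derive1E; exact: derivableP. Qed.

Section InvelopeBounds.
Context {R : realType} (h beta : R -> R) (alpha : nat) (M : R).
Context (alpha_even : ~~ odd alpha) (alpha2 : (2 <= alpha)%N).
Context (betaC : continuous beta).
Context (beta_le : forall t : R, `|beta t| <= M * (1 + `|t|)).
Context (M1 : 1 <= M).

Let y (t : R) := Defs.integral0 beta t + t ^+ (alpha + 2).

Context (hy : invelope h y).

Let n_even : ~~ odd (alpha + 2).
Proof. by rewrite oddD addbF. Qed.

Let n4 : (4 <= alpha + 2)%N.
Proof. exact: (leq_add alpha2 (leqnn 2)). Qed.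

Let hD (t : R) : is_derive t 1 h (derive1 h t).
Proof. by apply: derivable_is_derive1; have [_ /(_ t)[]] := hy. Qed.

Let h1D (t : R) : is_derive t 1 (derive1 h) (deriv2 h t).
Proof. by apply: derivable_is_derive1; have [_ /(_ t)[]] := hy. Qed.

Let XD (t : R) : is_derive t 1 (Defs.integral0 beta) (beta t).
Proof. exact: is_derive_integral0. Qed.

Let h_ge (t : R) : Defs.integral0 beta t + t ^+ (alpha + 2) <= h t.
Proof. by have [+ _ _ _] := hy; apply. Qed.

Let support (x z : R) : deriv2 h x + deriv3 h x * (z - x) <= deriv2 h z.
Proof. by have [_ _ conv _] := hy; exact: rderiv_support. Qed.

Let tch := touch h (Defs.integral0 beta) (alpha + 2).

(** The vanishing integral in [invelope] enters here: the third derivative can change only at touch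
    points. *)
Let deriv3_const (x z : R) : x <= z -> (forall s, x < s -> s <= z -> ~ tch s) ->
  deriv3 h x = deriv3 h z.
Proof.
move=> xz nt; have [_ _ _ [F [FE intF]]] := hy.
rewrite -!FE; apply: (cumulative_eq_of_integral_eq0 _ _ intF xz).
- move=> s; apply: continuousB; first exact: (is_derive_continuous hD).
  apply: continuousD; first exact: (is_derive_continuous XD).
  exact: exprn_continuous.
- by move=> s; rewrite subr_ge0; exact: h_ge.
- by move=> s xs sz /subr0_eq e; exact: (nt s).
Qed.

Let X0 : Defs.integral0 beta 0 = 0.
Proof. exact: integral0_0. Qed.

Lemma invelope_derivs_le :
  `|deriv2 h 0| <= 64 * (450 * hermite_const * M) /\
  `|deriv3 h 0| <= 64 * (450 * hermite_const * M).
Proof. exact: derivs_at0_bound hD h1D XD X0 beta_le M1 n_even n4 h_ge support deriv3_const. Qed.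

Lemma invelope_hplus_le t : 0 < t -> (t%:E < hplus h y)%E -> t <= 66 * hermite_const * M.
Proof.
move=> t0 th.
have := first_touch_right hD h1D XD X0 beta_le M1 n_even n4 h_ge support deriv3_const t0.
apply=> s s0 st ts; have : (hplus h y <= s%:E)%E by apply: ereal_inf_lbound; exists s.
by move=> /(lt_le_trans th); rewrite lte_fin ltNge st.
Qed.

Lemma invelope_hminus_le t : 0 < t -> (t%:E < hminus h y)%E -> t <= 66 * hermite_const * M.
Proof.
move=> t0 th.
have := first_touch_left hD h1D XD X0 beta_le M1 n_even n4 h_ge support deriv3_const t0.
apply=> s s0 st ts.
have : (s%:E <= ereal_sup (EFin @` [set s : R | (s < 0)%R /\ h s = y s]))%E.
  by apply: ereal_sup_ubound; exists s.
rewrite -leeN2 => /(lt_le_trans th); rewrite -EFinN lte_fin ltrNr; lra.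
Qed.

End InvelopeBounds.

(** * Outer probability and the passage from paths to tails *)

Section OuterProbability.
Context {R : realType} {d : measure_display} {Omega : measurableType d}.
Context (P : probability Omega R).

Lemma outerP_le (E A : set Omega) : measurable A -> E `<=` A -> (outerP P E <= P A)%E.
Proof. by move=> mA EA; apply: ereal_inf_lbound; exists A. Qed.

Lemma outerP_le1 (E : set Omega) : (outerP P E <= 1)%E.
Proof. by rewrite -(probability_setT P); exact: outerP_le. Qed.

(** [S] need not be measurable; it is covered by the growth exceptional event and two measurable
    null sets. *)
Lemma outerP_le_of_linear_growth (B : R -> Omega -> R) (Q : Omega -> Prop)
    (S : set Omega) (x : R) :
  two_sided_BM P B -> {ae P, forall w, Q w} -> 1 <= x ->
  (forall w, S w -> continuous (fun t => B t w) -> Q w ->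
    (forall t, `|B t w| <= 30 * x * (1 + `|t|)) -> False) ->
  (outerP P S <= ((4 + 16 * expR (1 / 2)) * expR (- x))%:E)%E.
Proof.
move=> BM aeQ x1 hS; have [E [mE PE growth]] := BM_linear_growth BM x1.
have [_ aeB _] := BM; have [N1 [mN1 N10 subN1]] := aeB; have [N2 [mN2 N20 subN2]] := aeQ.
apply: le_trans (outerP_le (A := E `|` (N1 `|` N2)) _ _) _.
- by apply: measurableU => //; exact: measurableU.
- move=> w Sw; have [Ew|nE] := pselect (E w); first by left.
  right; have [N1w|nN1] := pselect (N1 w); first by left.
  right; apply: contrapT => nN2.
  have [B0 Bc] : B 0 w = 0 /\ continuous (fun t => B t w).
    by apply: contrapT => nB; apply: nN1; apply: subN1.
  have Qw : Q w by apply: contrapT => nQ; apply: nN2; apply: subN2.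
  exact: (hS w Sw Bc Qw (growth w nE B0 Bc)).
- apply: (le_trans (measureU2 _ _ _)) => //; first exact: measurableU.
  rewrite -[leRHS]adde0; apply: leeD => //.
  apply: (le_trans (measureU2 _ _ _)) => //.
  by rewrite [X in (X + _)%E]N10 [X in (_ + X)%E]N20 adde0.
Qed.

End OuterProbability.

Theorem theorem4p1 (R : realType) :
  exists L b : R, 0 < L /\ 0 < b /\
  forall (alpha : nat), ~~ odd alpha -> (2 <= alpha)%N ->
  forall (d : measure_display) (Omega : measurableType d)
         (P : probability Omega R) (B : R -> Omega -> R) (H : Omega -> R -> R),
  two_sided_BM P B ->
  {ae P, forall w, invelope (H w) (Yproc alpha B w)} ->
  forall t : R, 0 < t ->
  let bound := (L * expR (- (t `^ b) / L))%:E in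
  [/\ (outerP P [set w | (t < `|deriv2 (H w) 0|)%R] <= bound)%E,
      (outerP P [set w | (t < `|deriv3 (H w) 0|)%R] <= bound)%E,
      (outerP P [set w | t%:E < hminus (H w) (Yproc alpha B w)] <= bound)%E &
      (outerP P [set w | t%:E < hplus (H w) (Yproc alpha B w)] <= bound)%E].
Proof.
(* The growth level will be [x = t / c]. The touch bound is strict because the estimate on [t] is
   not, whereas the derivative events already carry a strict inequality. *)
have [c [c1 c_deriv c_touch]] : exists c : R, [/\ 1 <= c,
    forall x, 64 * (450 * hermite_const * (30 * x)) = c * x &
    forall x, 1 <= x -> 66 * hermite_const * (30 * x) < c * x].
  have : 1 <= hermite_const :> R := hermite_const_ge1.
  move: hermite_const => K K1; exists (64 * (450 * K * 30)); split.
  - lra.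
  - by move=> x; ring.
  - by move=> x x1; have : 1 <= K * x; [exact: mulr_ege1|lra].
have [C [C0 CE]] : exists C : R, 0 <= C /\ C = 4 + 16 * expR (1 / 2).
  by eexists; split; last reflexivity; rewrite addr_ge0// mulr_ge0// expR_ge0.
have [e [e0 eE]] : exists e : R, 0 < e /\ e * expR (- 1) = 1.
  by exists (expR 1); rewrite expR_gt0 -expRD subrr expR0.
(* In [L], [c] handles the decay rate, [C] the prefactor, and [e] the range [t < c]. *)
exists (c + C + e), 1; have [L [L0 LE Lc LC]] :
    exists L : R, [/\ 0 < L, L = c + C + e, c <= L & C <= L].
  by exists (c + C + e); split=> //; lra.
rewrite -LE; split=> //; split=> // alpha ae a2 d Omega P B H BM aeH t t0 bound.
have key (S : set Omega) : (forall w x, S w -> 1 <= x -> t = c * x ->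
    continuous (fun s => B s w) -> invelope (H w) (Yproc alpha B w) ->
    (forall s, `|B s w| <= 30 * x * (1 + `|s|)) -> False) ->
  (outerP P S <= bound)%E.
  move=> hS; rewrite /bound powRr1 ?(ltW t0)//.
  (* For [t < c <= L] the bound is at least [e * exp(- 1) = 1], hence trivial. *)
  have [tc|ct] := ltP t c.
    apply: (le_trans (outerP_le1 _ _)); rewrite lee_fin.
    rewrite -eE; apply: ler_pM; rewrite ?expR_ge0 ?(ltW e0)//; first lra.
    by rewrite ler_expR mulNr lerN2 ler_pdivrMr// mul1r (le_trans (ltW tc)).
  have c0 : 0 < c by exact: lt_le_trans ltr01 c1.
  have x1 : 1 <= t / c by rewrite ler_pdivlMr ?mul1r.
  apply: (le_trans (outerP_le_of_linear_growth BM aeH x1 _)).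
    move=> w Sw Bc Hw; apply: (hS w (t / c)) => //.
    by rewrite mulrC divfK ?gt_eqF.
  rewrite lee_fin -CE; apply: ler_pM; rewrite ?expR_ge0//.
  by rewrite ler_expR mulNr lerN2 ler_pM2l// lef_pV2 ?posrE.
have M1 (x : R) : 1 <= x -> 1 <= 30 * x by lra.
split; apply: key => w x /= Sw x1 tE Bc Hw growth.
- have [+ _] := invelope_derivs_le ae a2 Bc growth (M1 x x1) Hw.
  by rewrite c_deriv -tE leNgt Sw.
- have [_ +] := invelope_derivs_le ae a2 Bc growth (M1 x x1) Hw.
  by rewrite c_deriv -tE leNgt Sw.
- have tle := invelope_hminus_le ae a2 Bc growth (M1 x x1) Hw t0 Sw.
  by have := le_lt_trans tle (c_touch x x1); rewrite -tE ltxx.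
- have tle := invelope_hplus_le ae a2 Bc growth (M1 x x1) Hw t0 Sw.
  by have := le_lt_trans tle (c_touch x x1); rewrite -tE ltxx.
Qed.
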